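(* Let $A,B_0,\dots,B_{n-1}$ be $\Sigma^0_2$ sets such that $(A,B_0,\dots,B_{n-1})$ is an Ahmad $n$-pair. Then $A$ has an Ahmad sequence.
   Context: $\le_e$ is enumeration reducibility: $A\le_e B$ iff $A=\Gamma(B):=\{x:\exists\text{ finite }D\subseteq B,\ \langle x,D\rangle\in\Gamma\}$ for some c.e. set $\Gamma$; $<_e$ as usual. $(\Gamma_e)_e$ is a standard listing of all c.e. sets. $0'_e=\emptyset'$ is the enumeration jump of $\emptyset$; $\Sigma^0_2$ sets are those $\le_e 0'_e$; all sets considered are $\Sigma^0_2$. $(A,B_0,\dots,B_{n-1})$ is an Ahmad $n$-pair if $A\not\le_e B_i$ for every $i<n$ and every $Z<_e A$ satisfies $Z\le_e B_i$ for some $i<n$. A computable function $f$ gives an Ahmad sequence for $A$ if $\{\Gamma_{f(n)}(0'_e):n\in\omega\}=\{X\subseteq\omega:X<_e A\}$. *)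

(* Defs.v *)
From Stdlib Require Cantor.
From mathcomp Require Import all_boot zify.
From mathcomp Require Import mathcomp_extra boolp classical_sets.

Set Implicit Arguments.
Unset Strict Implicit.
Unset Printing Implicit Defensive.

Local Open Scope classical_set_scope.

Definition pairn (x y : nat) : nat := Cantor.to_nat (x, y).

(* Programs for the unary partial recursive functions; functions of several
   arguments are represented through the pairing bijection pairn. *)
Inductive code : Type :=
| Zero
| Succ
| Fst
| Snd
| Pair of code & code
| Comp of code & code
| Prec of code & code
| Mu of code.

Fixpoint prec_graph (F G : nat -> nat -> Prop) (a n y : nat) : Prop :=
  if n is m.+1 then
    exists2 z, prec_graph F G a m z & G (pairn a (pairn m z)) y
  else F a y.

(* eval c is the graph of the partial function computed by c:
     Prec f g : <a, 0>   |-> f(a),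
                <a, m+1> |-> g(<a, <m, h(<a, m>)>>)  where h is Prec f g;
     Mu f     : x |-> the least y with f(<x, y>) = 0, f being defined (and
                non-zero) at all earlier <x, z>. *)
Fixpoint eval (c : code) (x y : nat) : Prop :=
  match c with
  | Zero => y = 0
  | Succ => y = x.+1
  | Fst => y = (Cantor.of_nat x).1
  | Snd => y = (Cantor.of_nat x).2
  | Pair f g => exists u v, [/\ eval f x u, eval g x v & y = pairn u v]
  | Comp f g => exists2 z, eval g x z & eval f z y
  | Prec f g => prec_graph (eval f) (eval g)
                  (Cantor.of_nat x).1 (Cantor.of_nat x).2 y
  | Mu f => eval f (pairn x y) 0 /\
            (forall z, z < y -> exists k, eval f (pairn x z) k.+1)
  end.

Definition computable (f : nat -> nat) : Prop :=
  exists c, forall x, eval c x (f x).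

Definition dom (c : code) : set nat := [set x | exists y, eval c x y].

Definition ce (G : set nat) : Prop := exists c, G = dom c.

Fixpoint encode (c : code) : nat :=
  match c with
  | Zero => 0
  | Succ => 1
  | Fst => 2
  | Snd => 3
  | Pair f g => 4 + 4 * pairn (encode f) (encode g)
  | Comp f g => 5 + 4 * pairn (encode f) (encode g)
  | Prec f g => 6 + 4 * pairn (encode f) (encode g)
  | Mu f => 7 + 4 * encode f
  end.

(* The standard listing of the c.e. sets: W e is the domain of the program
   with Goedel number e. *)
Definition W (e : nat) : set nat := [set x | exists2 c, encode c = e & dom c x].

(* The finite set with canonical index u, i.e. u is the sum of the 2 ^ x for
   x in Dset u. *)
Definition Dset (u : nat) : set nat := [set x | odd (u %/ 2 ^ x)].

Definition enum_op (G B : set nat) : set nat :=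
  [set x | exists u, Dset u `<=` B /\ G (pairn x u)].

Definition Gamma (e : nat) (B : set nat) : set nat := enum_op (W e) B.

Definition le_e (A B : set nat) : Prop := exists G, ce G /\ A = enum_op G B.

Definition lt_e (A B : set nat) : Prop := le_e A B /\ ~ le_e B A.

Definition join (A B : set nat) : set nat :=
  [set x.*2 | x in A] `|` [set x.*2.+1 | x in B].

Definition Kset (A : set nat) : set nat :=
  [set z | exists e x, z = pairn e x /\ Gamma e A x].

Definition jump (A : set nat) : set nat := join (Kset A) (~` Kset A).

Definition zero_jump : set nat := jump set0.

Definition Sigma02 (A : set nat) : Prop := le_e A zero_jump.

(* For n = 0 this only says that A is c.e.; the notion is meant for n >= 1. *)
Definition ahmad_pair (n : nat) (A : set nat) (B : 'I_n -> set nat) : Prop :=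
  (forall i, ~ le_e A (B i)) /\
  (forall Z, lt_e Z A -> exists i, le_e Z (B i)).

Definition ahmad_sequence (A : set nat) (f : nat -> nat) : Prop :=
  computable f /\
  [set Gamma (f n) zero_jump | n in [set: nat]] = [set X | lt_e X A].

Lemma pairn_inj x y x' y' : pairn x y = pairn x' y' -> x = x' /\ y = y'.
Proof. by move/Cantor.to_nat_inj => [-> ->]. Qed.

Lemma eval_fun c x y y' : eval c x y -> eval c x y' -> y = y'.
Proof.
elim: c x y y' => [||||f IHf g IHg|f IHf g IHg|f IHf g IHg|f IHf] x y y' /=;
  try by move=> -> ->.
- move=> [u [v [fu gv ->]]] [u' [v' [fu' gv' ->]]].
  by rewrite (IHf _ _ _ fu fu') (IHg _ _ _ gv gv').
- by move=> [z gz fy] [z' gz' fy']; rewrite (IHg _ _ _ gz' gz) in fy'; exact: IHf fy fy'.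
- elim: (Cantor.of_nat x).2 y y' => [|m IHm] y y' /=; first exact: IHf.
  by move=> [z hz gy] [z' hz' gy']; rewrite (IHm _ _ hz' hz) in gy'; exact: IHg gy gy'.
- move=> [fy ly] [fy' ly']; case: (ltngtP y y') => // lt.
  + by have [k fk] := ly' _ lt; have := IHf _ _ _ fy fk.
  + by have [k fk] := ly _ lt; have := IHf _ _ _ fy' fk.
Qed.

Lemma encode_inj : injective encode.
Proof.
elim=> [||||f IHf g IHg|f IHf g IHg|f IHf g IHg|f IHf]
  [||||f' g'|f' g'|f' g'|f'] //= E; try lia.
- have /pairn_inj[/IHf -> /IHg ->] // :
    pairn (encode f) (encode g) = pairn (encode f') (encode g') by lia.
- have /pairn_inj[/IHf -> /IHg ->] // :
    pairn (encode f) (encode g) = pairn (encode f') (encode g') by lia.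
- have /pairn_inj[/IHf -> /IHg ->] // :
    pairn (encode f) (encode g) = pairn (encode f') (encode g') by lia.
- by have /IHf -> : encode f = encode f' by lia.
Qed.

Lemma encode_surj e : exists c, encode c = e.
Proof.
elim/ltn_ind: e => e IH.
case: (ltnP e 4) => [|le4e].
  case: e IH => [|[|[|[|//]]]] _ _;
    by [exists Zero|exists Succ|exists Fst|exists Snd].
pose m := (e - 4) %/ 4.
have lt_m k : k <= m -> k < e by rewrite /m; lia.
have pairm : pairn (Cantor.of_nat m).1 (Cantor.of_nat m).2 = m.
  by rewrite /pairn -surjective_pairing Cantor.cancel_to_of.
have := Cantor.to_nat_non_decreasing (Cantor.of_nat m).1 (Cantor.of_nat m).2.
rewrite -/(pairn _ _) pairm => le_m.
have [|f Ef] := IH (Cantor.of_nat m).1; first by apply: lt_m; lia.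
have [|g Eg] := IH (Cantor.of_nat m).2; first by apply: lt_m; lia.
have [|h Eh] := IH m; first exact: lt_m.
have : (e - 4) %% 4 < 4 by rewrite ltn_mod.
case Er: ((e - 4) %% 4) => [|[|[|[|//]]]] _.
- by exists (Pair f g); rewrite /= Ef Eg pairm /m; lia.
- by exists (Comp f g); rewrite /= Ef Eg pairm /m; lia.
- by exists (Prec f g); rewrite /= Ef Eg pairm /m; lia.
- by exists (Mu h); rewrite /= Eh /m; lia.
Qed.

Lemma W_encode c : W (encode c) = dom c.
Proof.
by apply/seteqP; split=> x; [case=> d /encode_inj -> | exists c].
Qed.

Lemma range_W : range W = [set G | ce G].
Proof.
apply/seteqP; split=> G /=.
- by move=> [e _ <-]; have [c <-] := encode_surj e; exists c; rewrite W_encode.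
- by move=> [c ->]; exists (encode c) => //; rewrite W_encode.
Qed.

(* Main.v *)
Require Import Defs.
From Stdlib Require Cantor.
From mathcomp Require Import all_boot zify.
From mathcomp Require Import boolp classical_sets.

(** Transitivity of [le_e] and the two halves of the Ahmad property show that
    the sets strictly below [A] are exactly those of the form
    [Gamma e A = Gamma d (B i)]. The oracle [0'_e] contains the halting set and
    its complement, so it enumerates [X := Gamma e A] and [V := Gamma d (B i)]
    by increasing stages [X_t], [V_t] that it can decide, uniformly in
    [e], [d], [i]. Let [Y] be the set of [x < t] in [X_t] such that [X_t] and
    [V_t] agree on [0, x], over all [t]. If [X = V] then [Y = X]; otherwise, a
    point of difference bounds the [x] admitted at all late stages, so [Y] is
    finite, hence still strictly below [A], which is not c.e. The s-m-n theorem
    turns the uniform enumeration of the sets [Y] into an Ahmad sequence. *)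

Set Implicit Arguments.
Unset Strict Implicit.
Unset Printing Implicit Defensive.

Local Open Scope classical_set_scope.

(** * Projections of the pairing bijection *)

Definition fstn (x : nat) : nat := (Cantor.of_nat x).1.
Definition sndn (x : nat) : nat := (Cantor.of_nat x).2.

Lemma fstn_pairn x y : fstn (pairn x y) = x.
Proof. by rewrite /fstn /pairn Cantor.cancel_of_to. Qed.

Lemma sndn_pairn x y : sndn (pairn x y) = y.
Proof. by rewrite /sndn /pairn Cantor.cancel_of_to. Qed.

Lemma pairn_fst_snd x : pairn (fstn x) (sndn x) = x.
Proof. by rewrite /fstn /sndn /pairn -surjective_pairing Cantor.cancel_to_of. Qed.

Definition pairnE := (fstn_pairn, sndn_pairn, pairn_fst_snd).

Arguments pairn : simpl never.

(** * Computable functions *)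

Lemma computable_id : computable id.
Proof.
by exists (Pair Fst Snd) => x; exists (fstn x), (sndn x); rewrite pairn_fst_snd.
Qed.

Fixpoint const_code (n : nat) : code :=
  if n is m.+1 then Comp Succ (const_code m) else Zero.

Lemma eval_const n x : eval (const_code n) x n.
Proof. by elim: n => //= n IH; exists n. Qed.

Lemma computable_const n : computable (fun=> n).
Proof. by exists (const_code n) => x; apply: eval_const. Qed.

Lemma computable_comp f g :
  computable f -> computable g -> computable (fun x => f (g x)).
Proof. by move=> [c Hc] [d Hd]; exists (Comp c d) => x; exists (g x). Qed.

Lemma computable_succ f : computable f -> computable (fun x => (f x).+1).
Proof. by move=> [c Hc]; exists (Comp Succ c) => x; exists (f x). Qed.

Lemma computable_fst f : computable f -> computable (fun x => fstn (f x)).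
Proof. by move=> [c Hc]; exists (Comp Fst c) => x; exists (f x). Qed.

Lemma computable_snd f : computable f -> computable (fun x => sndn (f x)).
Proof. by move=> [c Hc]; exists (Comp Snd c) => x; exists (f x). Qed.

Lemma computable_pair f g :
  computable f -> computable g -> computable (fun x => pairn (f x) (g x)).
Proof.
by move=> [c Hc] [d Hd]; exists (Pair c d) => x; exists (f x), (g x).
Qed.

Definition recn (a : nat) (h : nat -> nat -> nat) (n : nat) : nat :=
  nat_rec (fun=> nat) a h n.

(** [Prec] is run on [<x, n x>], so base and step may both depend on the parameter [x]. Arithmetic
    functions are shown computable below by rewriting them as instances of [recn]. *)
Lemma computable_rec a (h : nat -> nat -> nat -> nat) n :
  computable a ->
  computable (fun z => h (fstn z) (fstn (sndn z)) (sndn (sndn z))) ->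
  computable n -> computable (fun x => recn (a x) (h x) (n x)).
Proof.
move=> [ca Ha] [ch Hh] [cn Hn]; have [ci Hi] := computable_id.
exists (Comp (Prec ca ch) (Pair ci cn)) => x /=.
exists (pairn x (n x)); first by exists x, (n x).
rewrite -/(fstn _) -/(sndn _) !pairnE.
elim: (n x) => //= m IH; exists (recn (a x) (h x) m) => //.
by move: (Hh (pairn x (pairn m (recn (a x) (h x) m)))); rewrite !pairnE.
Qed.

Ltac computability :=
  repeat first [ exact: computable_id | exact: computable_const | eassumption
  | apply: computable_fst | apply: computable_snd | apply: computable_pair
  | apply: computable_succ ].

Lemma computable_add f g :
  computable f -> computable g -> computable (fun x => f x + g x).
Proof.
move=> Hf Hg.
have -> : (fun x => f x + g x) = (fun x => recn (f x) (fun _ z => z.+1) (g x)).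
  by apply/funext => x; elim: (g x) => [|m]; rewrite ?addn0 // addnS => ->.
by apply: (computable_rec (h := fun _ _ z => z.+1)); computability.
Qed.

Lemma computable_pred f : computable f -> computable (fun x => (f x).-1).
Proof.
move=> Hf; have -> : (fun x => (f x).-1) = (fun x => recn 0 (fun m _ => m) (f x)).
  by apply/funext => x; case: (f x).
by apply: (computable_rec (h := fun _ m _ => m)); computability.
Qed.

Lemma computable_sub f g :
  computable f -> computable g -> computable (fun x => f x - g x).
Proof.
move=> Hf Hg.
have -> : (fun x => f x - g x) = (fun x => recn (f x) (fun _ z => z.-1) (g x)).
  by apply/funext => x; elim: (g x) => [|m]; rewrite ?subn0 // subnS => ->.
by apply: (computable_rec (h := fun _ _ z => z.-1)); computability;
  apply: computable_pred; computability.
Qed.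

Lemma computable_mul f g :
  computable f -> computable g -> computable (fun x => f x * g x).
Proof.
move=> Hf Hg.
have -> : (fun x => f x * g x) = (fun x => recn 0 (fun _ z => f x + z) (g x)).
  by apply/funext => x; elim: (g x) => [|m]; rewrite ?muln0 // mulnS => ->.
apply: (computable_rec (h := fun x _ z => f x + z)); computability.
by apply: computable_add; computability; apply: computable_comp; computability.
Qed.

Lemma computable_exp2 f : computable f -> computable (fun x => 2 ^ f x).
Proof.
move=> Hf.
have -> : (fun x => 2 ^ f x) = (fun x => recn 1 (fun _ z => 2 * z) (f x)).
  by apply/funext => x; elim: (f x) => [|m] //; rewrite expnS => ->.
by apply: (computable_rec (h := fun _ _ z => 2 * z)); computability;
  apply: computable_mul; computability.
Qed.

(** A boolean is coerced to 0 or 1, so a case distinction is a recursion of length at most one,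
    starting from the [else] branch. *)
Lemma computable_if (p : nat -> bool) f g :
  computable p -> computable f -> computable g ->
  computable (fun x => if p x then f x else g x).
Proof.
move=> Hp Hf Hg.
have -> : (fun x => if p x then f x else g x) =
          (fun x => recn (g x) (fun _ _ => f x) (p x)).
  by apply/funext => x; case: (p x).
apply: (computable_rec (h := fun x _ _ => f x)); computability.
by apply: computable_comp; computability.
Qed.

Lemma computable_leq f g :
  computable f -> computable g -> computable (fun x => f x <= g x : bool).
Proof.
move=> Hf Hg.
have -> : (fun x => nat_of_bool (f x <= g x)) = (fun x => 1 - (f x - g x)).
  by apply/funext => x; case: leqP; lia.
by do 2![apply: computable_sub; computability].
Qed.

Lemma computable_and (p q : nat -> bool) :
  computable p -> computable q -> computable (fun x => p x && q x).
Proof.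
move=> Hp Hq.
have -> : (fun x => nat_of_bool (p x && q x)) = (fun x => p x * q x).
  by apply/funext => x; case: (p x); case: (q x).
exact: computable_mul.
Qed.

Lemma computable_not (p : nat -> bool) :
  computable p -> computable (fun x => ~~ p x).
Proof.
move=> Hp.
have -> : (fun x => nat_of_bool (~~ p x)) = (fun x => 1 - p x).
  by apply/funext => x; case: (p x).
by apply: computable_sub; computability.
Qed.

Lemma computable_eq f g :
  computable f -> computable g -> computable (fun x => f x == g x).
Proof.
move=> Hf Hg.
have -> : (fun x => nat_of_bool (f x == g x)) =
          (fun x => nat_of_bool ((f x <= g x) && (g x <= f x))).
  by apply/funext => x; rewrite eqn_leq.
by apply: computable_and; apply: computable_leq.
Qed.

Lemma computable_odd f : computable f -> computable (fun x => odd (f x)).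
Proof.
move=> Hf.
have -> : (fun x => nat_of_bool (odd (f x))) =
          (fun x => recn 0 (fun _ z => 1 - z) (f x)).
  by apply/funext => x; elim: (f x) => [|m] //=; rewrite /recn /= => <-; case: odd.
by apply: (computable_rec (h := fun _ _ z => 1 - z)); computability;
  apply: computable_sub; computability.
Qed.

Lemma computable_half f : computable f -> computable (fun x => (f x)./2).
Proof.
move=> Hf.
have -> : (fun x => (f x)./2) = (fun x => recn 0 (fun m z => odd m + z) (f x)).
  apply/funext => x; elim: (f x) => [|m] //.
  by rewrite -[m.+1./2]/(uphalf m) uphalf_half => ->.
by apply: (computable_rec (h := fun _ m z => odd m + z)); computability;
  apply: computable_add; computability; apply: computable_odd; computability.
Qed.

Definition bit (u x : nat) : bool := odd (u %/ 2 ^ x).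

Lemma computable_bit f g :
  computable f -> computable g -> computable (fun x => bit (f x) (g x)).
Proof.
move=> Hf Hg; apply: computable_odd.
have -> : (fun x => f x %/ 2 ^ g x) = (fun x => recn (f x) (fun _ z => z./2) (g x)).
  apply/funext => x; elim: (g x) => [|m]; first by rewrite expn0 divn1.
  by rewrite expnSr divnMA divn2 => ->.
by apply: (computable_rec (h := fun _ _ z => z./2)); computability;
  apply: computable_half; computability.
Qed.

Lemma computable_mem (s : seq nat) f :
  computable f -> computable (fun x => f x \in s).
Proof.
move=> Hf; elim: s => [|a s IH].
  have -> : (fun x => nat_of_bool (f x \in [::])) = (fun=> 0) by [].
  exact: computable_const.
have -> : (fun x => nat_of_bool (f x \in a :: s)) =
          (fun x => if f x == a then 1 else f x \in s).
  by apply/funext => x; rewrite inE; case: eqP.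
by apply: computable_if; computability; apply: computable_eq; computability.
Qed.

(** * Finite sets *)

Lemma bit_lt u x : bit u x -> x < u.
Proof.
rewrite /bit; case: (ltnP x u) => // le_ux.
by rewrite divn_small //; apply: leq_ltn_trans le_ux _; apply: ltn_expl.
Qed.

Lemma Dset0 : Dset 0 = set0.
Proof. by apply/seteqP; split=> x //=; rewrite /Dset /= div0n. Qed.

(** Since bit [k] of [u] is 0, the addition produces no carry. *)
Lemma bit_add u k x : ~~ bit u k -> bit (u + 2 ^ k) x = bit u x || (x == k).
Proof.
rewrite /bit => Huk; case: (ltngtP x k) => [lt_xk|lt_kx|->].
(* Below [k], the summand [2 ^ k] is an even multiple of [2 ^ x], so the parity of the quotient is
   unchanged. *)
- have -> : k = (k - x.+1 + 1) + x by lia.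
  by rewrite orbF expnD divnDMl ?expn_gt0 // expnD expn1 oddD oddM andbF addbF.
(* Above [k], the quotient by [2 ^ k] is even, and adding 1 to it does not change its half. *)
- have -> : x = k + (1 + (x - k.+1)) by lia.
  rewrite orbF expnD !divnMA divnDr ?dvdnn // divnn expn_gt0 /= addn1.
  rewrite expnD expn1 !divnMA !divn2.
  by rewrite -[(_.+1)./2]/(uphalf _) uphalf_half (negbTE Huk).
- by rewrite divnDr ?dvdnn // divnn expn_gt0 addn1 /= Huk orbT.
Qed.

Lemma Dset_exp2 k : Dset (2 ^ k) = [set k].
Proof.
have H x : bit (2 ^ k) x = (x == k).
  by rewrite -[2 ^ k]add0n bit_add /bit div0n.
by apply/seteqP; split=> x; rewrite /Dset /= -/(bit _ _) H => /eqP.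
Qed.

(** A recursion over [k < v] suffices, because the bits of [v] lie below [v] by [bit_lt]; testing
    [bit z k] before adding excludes carries. *)
Definition unionn (u v : nat) : nat :=
  recn u (fun k z => if bit v k && ~~ bit z k then z + 2 ^ k else z) v.


Lemma bit_unionn_rec u v m x :
  bit (recn u (fun k z => if bit v k && ~~ bit z k then z + 2 ^ k else z) m) x
    = bit u x || (x < m) && bit v x.
Proof.
elim: m x => [|m IH] x /=; first by rewrite orbF.
rewrite ltnS leq_eqVlt; set r := recn _ _ _ in IH *.
have := IH m; rewrite ltnn orbF => Hr.
case: ifP => [/andP[Hv Hrm]|]; first by rewrite bit_add // IH;
  case: (eqVneq x m) => [->|_] //=; rewrite ?Hv ?orbT ?orbF.
rewrite IH; case: (eqVneq x m) => [->|_] //=.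
by rewrite ltnn /= Hr; case: (bit v m); case: (bit u m).
Qed.

Lemma Dset_unionn u v : Dset (unionn u v) = Dset u `|` Dset v.
Proof.
apply/seteqP; split=> x; rewrite /Dset /= -/(bit _ _) -!/(bit _ x) bit_unionn_rec.
  by case/orP => [|/andP[]]; [left|right].
by case=> [->|H] //; rewrite H (bit_lt H) orbT.
Qed.

Lemma computable_unionn f g :
  computable f -> computable g -> computable (fun x => unionn (f x) (g x)).
Proof.
move=> Hf Hg.
apply: (computable_rec (h := fun x k z =>
  if bit (g x) k && ~~ bit z k then z + 2 ^ k else z)); computability.
apply: computable_if; computability.
- apply: computable_and; last apply: computable_not; apply: computable_bit;
    computability; apply: computable_comp; computability.
- by apply: computable_add; computability; apply: computable_exp2; computability.
Qed.

(** * Coding of finite sequences *)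

(** A number is read as a right-nested tuple [<h 0, <h 1, ...>>]. No length is stored, so every
    number is a code. *)
Definition nthn (w y : nat) : nat := fstn (recn w (fun _ z => sndn z) y).

Lemma nthn_exists (h : nat -> nat) t : exists w, forall y, y < t -> nthn w y = h y.
Proof.
elim: t h => [|t IH] h; first by exists 0.
have [w Hw] := IH (fun y => h y.+1); exists (pairn (h 0) w).
have E y : recn (pairn (h 0) w) (fun _ z => sndn z) y.+1
         = recn w (fun _ z => sndn z) y.
  by elim: y => [|y IHy] /=; [rewrite pairnE | rewrite -IHy].
by case=> [|y] lt_y; rewrite /nthn; [rewrite /= pairnE | rewrite E; apply: Hw].
Qed.

Lemma computable_nthn f g :
  computable f -> computable g -> computable (fun x => nthn (f x) (g x)).
Proof.
move=> Hf Hg; apply: computable_fst.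
by apply: (computable_rec (h := fun _ _ z => sndn z)); computability.
Qed.

(* Matching is on the syntax of the body: unification up to conversion unfolds
   the arithmetic operations and does not terminate in practice. *)
Ltac computability ::=
  repeat (cbv beta; first [eassumption | lazymatch goal with
  | |- computable id => exact computable_id
  | |- computable fstn => exact (computable_fst computable_id)
  | |- computable sndn => exact (computable_snd computable_id)
  | |- computable (fun x => x) => exact computable_id
  | |- computable (fun _ => ?c) => exact (computable_const c)
  | |- computable (fun x => fstn (@?f x)) => apply (@computable_fst f)
  | |- computable (fun x => sndn (@?f x)) => apply (@computable_snd f)
  | |- computable (fun x => pairn (@?f x) (@?g x)) => apply (@computable_pair f g)
  | |- computable (fun x => S (@?f x)) => apply (@computable_succ f)
  | |- computable (fun x => addn (@?f x) (@?g x)) => apply (@computable_add f g)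
  | |- computable (fun x => muln (@?f x) (@?g x)) => apply (@computable_mul f g)
  | |- computable (fun x => subn (@?f x) (@?g x)) => apply (@computable_sub f g)
  | |- computable (fun x => expn 2 (@?f x)) => apply (@computable_exp2 f)
  | |- computable (fun x => unionn (@?f x) (@?g x)) =>
      apply (@computable_unionn f g)
  | |- computable (fun x => nthn (@?f x) (@?g x)) => apply (@computable_nthn f g)
  | |- computable (fun x => nat_of_bool (bit (@?f x) (@?g x))) =>
      apply (@computable_bit f g)
  | |- computable (fun x => nat_of_bool (odd (@?f x))) => apply (@computable_odd f)
  | |- computable (fun x => nat_of_bool (andb (@?p x) (@?q x))) =>
      apply (@computable_and p q)
  | |- computable (fun x => nat_of_bool (negb (@?p x))) =>
      apply (@computable_not p)
  | |- computable (fun x => nat_of_bool (eq_op (@?f x) (@?g x))) =>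
      apply (@computable_eq f g)
  | |- computable (fun x => nat_of_bool (leq (@?f x) (@?g x))) =>
      apply (@computable_leq f g)
  | |- computable (fun x => nat_of_bool (in_mem (@?f x) (mem ?s))) =>
      apply (@computable_mem s f)
  | H : computable ?f |- computable (fun x => ?f (@?g x)) =>
      apply (@computable_comp f g H)
  | H : computable (fun z => nat_of_bool (?p z))
      |- computable (fun x => nat_of_bool (?p (@?g x))) =>
      apply (@computable_comp (fun z => nat_of_bool (p z)) g H)
  end]).

(** * Enumerability relative to an oracle *)

(* The normal form of [le_e P O] from which the quantifier closure properties
   are read off: a decidable matrix and a computable finite query. *)
Definition enumerable (O : set nat) (P : nat -> Prop) : Prop :=
  exists (b : nat -> bool) (g : nat -> nat), [/\ computable b, computable g &
    forall x, P x <-> exists w, b (pairn x w) /\ Dset (g (pairn x w)) `<=` O].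

Section Enumerable.
Variable O : set nat.

Lemma enumerable_iff (P Q : nat -> Prop) :
  (forall x, P x <-> Q x) -> enumerable O P -> enumerable O Q.
Proof. by move=> PQ; have <- // : P = Q by apply/funext => x; apply/propext. Qed.

Lemma enumerable_dec (p : nat -> bool) :
  computable p -> enumerable O (fun x => p x).
Proof.
(* The query [0] codes the empty set, which every oracle contains; the witness is ignored. *)
move=> Hp; exists (fun z => p (fstn z)), (fun=> 0); split; computability.
move=> x; split=> [px|[w]]; last by rewrite !pairnE => -[].
by exists 0; rewrite !pairnE Dset0; split=> //; apply: sub0set.
Qed.

Lemma enumerable_query f :
  computable f -> enumerable O (fun x => Dset (f x) `<=` O).
Proof.
move=> Hf; exists (fun=> true), (fun z => f (fstn z)); split; computability.
move=> x; split=> [px|[w]]; last by rewrite !pairnE => -[].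
by exists 0; rewrite !pairnE.
Qed.

Lemma enumerable_oracle f : computable f -> enumerable O (fun x => O (f x)).
Proof.
move=> Hf; apply: (@enumerable_iff (fun x => Dset (2 ^ f x) `<=` O)).
  by move=> x; rewrite Dset_exp2; split=> [|Ox y ->] //; apply.
by apply: enumerable_query; computability.
Qed.

Lemma enumerable_comp P f :
  enumerable O P -> computable f -> enumerable O (fun x => P (f x)).
Proof.
move=> [b [g [Hb Hg HP]]] Hf.
exists (fun z => b (pairn (f (fstn z)) (sndn z))),
       (fun z => g (pairn (f (fstn z)) (sndn z))).
split; computability.
by move=> x; rewrite HP; split=> -[w]; rewrite ?pairnE => H; exists w; rewrite ?pairnE.
Qed.

Lemma enumerable_comp2 (P : nat -> nat -> Prop) f g :
  enumerable O (fun z => P (fstn z) (sndn z)) -> computable f -> computable g ->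
  enumerable O (fun x => P (f x) (g x)).
Proof.
move=> HP Hf Hg; apply: (@enumerable_iff
  (fun x => P (fstn (pairn (f x) (g x))) (sndn (pairn (f x) (g x))))).
  by move=> x; rewrite !pairnE.
by apply: (enumerable_comp HP); computability.
Qed.

(** A witness is a pair of witnesses, and the two queries are merged by [unionn]. *)
Lemma enumerable_and P Q :
  enumerable O P -> enumerable O Q -> enumerable O (fun x => P x /\ Q x).
Proof.
move=> [b [g [Hb Hg HP]]] [b' [g' [Hb' Hg' HQ]]].
exists (fun z => b (pairn (fstn z) (fstn (sndn z))) &&
                 b' (pairn (fstn z) (sndn (sndn z)))),
       (fun z => unionn (g (pairn (fstn z) (fstn (sndn z))))
                        (g' (pairn (fstn z) (sndn (sndn z))))).
split; computability; move=> x; rewrite HP HQ; split.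
- move=> [[w [bw gw]] [w' [bw' gw']]]; exists (pairn w w').
  by rewrite !pairnE bw bw' Dset_unionn subUset.
- move=> [w]; rewrite !pairnE Dset_unionn subUset => -[/andP[bw bw'] [gw gw']].
  by split; [exists (fstn w) | exists (sndn w)].
Qed.

(** The first component of the witness is a tag choosing the disjunct: 0 for the left one, anything
    else for the right one. *)
Lemma enumerable_or P Q :
  enumerable O P -> enumerable O Q -> enumerable O (fun x => P x \/ Q x).
Proof.
move=> [b [g [Hb Hg HP]]] [b' [g' [Hb' Hg' HQ]]].
pose arg z := pairn (fstn z) (sndn (sndn z)).
have Harg : computable arg by rewrite /arg; computability.
exists (fun z => (fstn (sndn z) == 0) && b (arg z) ||
                 ~~ (fstn (sndn z) == 0) && b' (arg z)),
       (fun z => if fstn (sndn z) == 0 then g (arg z) else g' (arg z)).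
split; last move=> x.
- have -> : (fun z => nat_of_bool ((fstn (sndn z) == 0) && b (arg z) ||
                 ~~ (fstn (sndn z) == 0) && b' (arg z))) =
     (fun z => if fstn (sndn z) == 0 then nat_of_bool (b (arg z)) else b' (arg z)).
    by apply/funext => z; case: eqP => //=; rewrite orbF.
  by apply: computable_if; computability.
- by apply: computable_if; computability.
rewrite HP HQ /arg; split.
- by case=> -[w bw]; [exists (pairn 0 w)|exists (pairn 1 w)];
    rewrite !pairnE ?orbF //= ?orbF.
- move=> [w]; rewrite !pairnE; case: eqP => _ /=; rewrite ?orbF => H.
  + by left; exists (sndn w).
  + by right; exists (sndn w).
Qed.

Lemma enumerable_ex (P : nat -> nat -> Prop) :
  enumerable O (fun z => P (fstn z) (sndn z)) ->
  enumerable O (fun x => exists y, P x y).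
Proof.
move=> [b [g [Hb Hg HP]]].
pose arg z := pairn (pairn (fstn z) (fstn (sndn z))) (sndn (sndn z)).
have Harg : computable arg by rewrite /arg; computability.
exists (fun z => b (arg z)), (fun z => g (arg z)); split; computability.
move=> x; split=> [[y]|[w]].
- rewrite -{1}[x](fstn_pairn x y) -{2}[y](sndn_pairn x y) => /HP[w Hw].
  by exists (pairn y w); rewrite /arg !pairnE.
- rewrite /arg !pairnE => Hw; exists (fstn w).
  by have := (HP (pairn x (fstn w))).2; rewrite !pairnE; apply; exists (sndn w).
Qed.

(** A single witness codes a sequence of witnesses, one for each [y] below the bound, and the
    finitely many queries are united into one. *)
Lemma enumerable_ball (P : nat -> nat -> Prop) t : computable t ->
  enumerable O (fun z => P (fstn z) (sndn z)) ->
  enumerable O (fun x => forall y, y < t x -> P x y).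
Proof.
move=> Ht [b [g [Hb Hg HP]]].
pose arg z y := pairn (pairn (fstn z) y) (nthn (sndn z) y).
(* [nb z n] counts the [y < n] at which the matrix fails; [gg z n] is the union of the queries for
   [y < n]. *)
pose nb z n := recn 0 (fun y r => ~~ b (arg z y) + r) n.
pose gg z n := recn 0 (fun y r => unionn (g (arg z y)) r) n.
exists (fun z => nb z (t (fstn z)) == 0), (fun z => gg z (t (fstn z))).
have nbP z n : (nb z n == 0) <-> forall y, y < n -> b (arg z y).
  elim: n => [|n IH] //=; rewrite /nb /= -/(nb z n) addn_eq0; split.
  - case/andP; rewrite eqb0 negbK => bn /IH H y.
    by rewrite ltnS leq_eqVlt => /orP[/eqP-> //|]; apply: H.
  - move=> H; rewrite eqb0 negbK H //=; apply/IH => y lt_y.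
    by apply: H; apply: ltnW.
have ggP z n : Dset (gg z n) `<=` O <-> forall y, y < n -> Dset (g (arg z y)) `<=` O.
  elim: n => [|n IH]; first by rewrite /gg /= Dset0; split=> // _ ?.
  rewrite /gg /= -/(gg z n) Dset_unionn subUset; split.
  - move=> [gn /IH H] y; rewrite ltnS leq_eqVlt => /orP[/eqP-> //|]; apply: H.
  - by move=> H; split; [apply: H | apply/IH => y lt_y; apply: H; apply: ltnW].
split.
- apply: computable_eq; last by computability.
  apply: (computable_rec (h := fun z y r => ~~ b (arg z y) + r));
    rewrite /arg; computability.
- apply: (computable_rec (h := fun z y r => unionn (g (arg z y)) r));
    rewrite /arg; computability.
move=> x; split=> [H|[w [/nbP Hb' /ggP Hg']] y lt_y].
(* The bound is moved under the existential, with default witness 0 beyond it, so that choice yields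
   a total function. *)
- have H' y : exists w, y < t x ->
      b (pairn (pairn x y) w) /\ Dset (g (pairn (pairn x y) w)) `<=` O.
    have [lt_y|] := boolP (y < t x); last by exists 0.
    have [|w Hw] := (HP (pairn x y)).1; first by rewrite !pairnE; apply: H.
    by exists w.
  have [h Hh] := choice H'; have [w Hw] := nthn_exists h (t x).
  exists w; split.
  + by apply/nbP => y; rewrite /arg !pairnE => lt_y; rewrite Hw //; case: (Hh y lt_y).
  + by apply/ggP => y; rewrite /arg !pairnE => lt_y; rewrite Hw //; case: (Hh y lt_y).
- rewrite /arg !pairnE in Hb' Hg'.
  have := (HP (pairn x y)).2; rewrite !pairnE; apply; exists (nthn w y).
  by split; [have := Hb' y lt_y|have := Hg' y lt_y]; rewrite ?pairnE.
Qed.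

Lemma enumerable_bex (P : nat -> nat -> Prop) t : computable t ->
  enumerable O (fun z => P (fstn z) (sndn z)) ->
  enumerable O (fun x => exists y, y < t x /\ P x y).
Proof.
move=> Ht HP; apply: enumerable_ex; apply: enumerable_and => //.
by apply: enumerable_dec; computability.
Qed.

Lemma enumerable_imp (p : nat -> bool) P :
  computable p -> enumerable O P -> enumerable O (fun x => p x -> P x).
Proof.
move=> Hp HP; apply: (@enumerable_iff (fun x => ~~ p x \/ P x)).
  by move=> x; case: (p x); split => //; [case | right; exact: H | left].
by apply: enumerable_or => //; apply: enumerable_dec; computability.
Qed.

(** Coding the course of values by one number turns the recursion into an existential quantifier
    over a bounded universal one, to which the closure lemmas apply. *)
Lemma prec_graphP (F G : nat -> nat -> Prop) a n y :
  prec_graph F G a n y <-> exists w, [/\ F a (nthn w 0),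
    forall m, m < n -> G (pairn a (pairn m (nthn w m))) (nthn w m.+1)
    & nthn w n = y].
Proof.
split=> [H|[w [F0 HG <-]]]; last first.
  elim: n HG => [|n IH] //= HG; exists (nthn w n); last exact: HG.
  by apply: IH => m lt_m; apply: HG; apply: ltnW.
suff [h [h0 hS hn]] : exists h, [/\ F a (h 0),
    forall m, m < n -> G (pairn a (pairn m (h m))) (h m.+1) & h n = y].
  have [w Hw] := nthn_exists h n.+1; exists w; rewrite !Hw //; split=> // m lt_m.
  by rewrite !Hw ?ltnS //; [apply: hS | apply: ltnW].
elim: n y H => [|n IH] y /=; first by exists (fun=> y).
move=> [z /IH [h [h0 hS hn]] Gy]; exists (fun m => if m <= n then h m else y).
split; rewrite ?ltnn // => m; rewrite ltnS leq_eqVlt => /orP[/eqP->|lt_m].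
  by rewrite eqxx ltnn hn.
by rewrite lt_m orbT; apply: hS.
Qed.

(** The oracle is arbitrary: by induction on the program, its graph is built from decidable
    relations by conjunction, existential and bounded universal quantification. *)
Lemma enumerable_eval c : enumerable O (fun z => eval c (fstn z) (sndn z)).
Proof.
have eq_enum f g : computable f -> computable g -> enumerable O (fun x => f x = g x).
  move=> Hf Hg; apply: (@enumerable_iff (fun x => f x == g x)).
    by move=> x; split=> /eqP.
  by apply: enumerable_dec; computability.
elim: c => [||||f IHf g IHg|f IHf g IHg|f IHf g IHg|f IHf] /=;
  rewrite -?/(fstn _) -?/(sndn _).
- by apply: eq_enum; computability.
- by apply: eq_enum; computability.
- by apply: eq_enum; computability; apply: computable_fst; computability.
- by apply: eq_enum; computability; apply: computable_snd; computability.
- apply: (@enumerable_iff (fun z => exists u, exists v, eval f (fstn z) u /\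
    (eval g (fstn z) v /\ sndn z = pairn u v))).
    by move=> z; split=> -[u [v]] [H1]; [move=> [H2 H3]|move=> H2 H3]; exists u, v.
  apply: enumerable_ex; apply: enumerable_ex; apply: enumerable_and.
    by apply: enumerable_comp2; computability.
  apply: enumerable_and; last by apply: eq_enum; computability.
  by apply: enumerable_comp2; computability.
- apply: (@enumerable_iff (fun z => exists u, eval g (fstn z) u /\ eval f u (sndn z))).
    by move=> z; split=> -[u]; [move=> []; exists u|exists u].
  by apply: enumerable_ex; apply: enumerable_and; apply: enumerable_comp2; computability.
- apply: (@enumerable_iff (fun z => exists w,
    eval f (fstn (fstn z)) (nthn w 0) /\
    ((forall m, m < sndn (fstn z) -> eval g
       (pairn (fstn (fstn z)) (pairn m (nthn w m))) (nthn w m.+1)) /\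
     nthn w (sndn (fstn z)) = sndn z))).
    move=> z; rewrite prec_graphP.
    by split=> -[w] [H1]; [move=> [H2 H3]|move=> H2 H3]; exists w.
  apply: enumerable_ex; apply: enumerable_and.
    by apply: enumerable_comp2; computability.
  apply: enumerable_and; last by apply: eq_enum; computability.
  apply: enumerable_ball; computability.
  by apply: enumerable_comp2; computability.
- apply: enumerable_and; first by apply: enumerable_comp2; computability.
  apply: enumerable_ball; computability.
  by apply: enumerable_ex; apply: enumerable_comp2; computability.
Qed.

Lemma enumerable_dom c f : computable f -> enumerable O (fun x => dom c (f x)).
Proof.
move=> Hf; apply: enumerable_ex.
by apply: (enumerable_comp2 (enumerable_eval c)); computability.
Qed.

(** Elements of [Dset (u x)] lie below [u x], so the inclusion is a bounded quantifier. *)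
Lemma enumerable_subset (P : nat -> nat -> Prop) u : computable u ->
  enumerable O (fun z => P (fstn z) (sndn z)) ->
  enumerable O (fun x => Dset (u x) `<=` P x).
Proof.
move=> Hu HP; apply: (@enumerable_iff
  (fun x => forall y, y < u x -> bit (u x) y -> P x y)).
  by move=> x; split=> H y; [move=> Hy; apply: H => //; apply: bit_lt | move=> _; apply: H].
by apply: enumerable_ball => //; apply: enumerable_imp => //; computability.
Qed.

Lemma enumerable_le_e (X : set nat) : le_e X O -> enumerable O X.
Proof.
move=> [G [[c ->]] ->]; apply: enumerable_ex; apply: enumerable_and.
  by apply: enumerable_query; computability.
by apply: enumerable_dom; computability.
Qed.

End Enumerable.

(** * Unbounded search and the s-m-n theorem *)

Lemma ce_ex (b : nat -> bool) : computable b -> ce [set x | exists w, b (pairn x w)].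
Proof.
move=> Hb.
(* [Mu] searches for a zero, hence the negation. *)
have [c Hc] : computable (fun x => ~~ b x) by computability.
exists (Mu c); apply/seteqP; split=> x /=; last first.
  move=> [w [Hw _]]; exists w; have := eval_fun Hw (Hc _).
  by case: (b _).
move=> H; have [w bw wmin] := ex_minnP H.
exists w; split=> [|z lt_z]; first by have := Hc (pairn x w); rewrite bw.
exists 0; have := Hc (pairn x z); suff /negbTE-> : ~~ b (pairn x z) by [].
by apply: contraTN lt_z => /wmin; rewrite -leqNgt.
Qed.

(** The constant [n] is hard-wired as first component of the input; [Pair Fst Snd] is the identity
    program. *)
Definition smn (c : code) (n : nat) : code :=
  Comp c (Pair (const_code n) (Pair Fst Snd)).

Lemma dom_smn c n x : dom (smn c n) x <-> dom c (pairn n x).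
Proof.
have evalP z : (exists u v, [/\ eval (const_code n) x u, eval (Pair Fst Snd) x v
     & z = pairn u v]) <-> z = pairn n x.
  have Hid : eval (Pair Fst Snd) x x.
    by exists (fstn x), (sndn x); rewrite pairn_fst_snd.
  split=> [[u [v [Hu Hv ->]]]|->].
    by rewrite (eval_fun Hu (eval_const n x)) (eval_fun Hv Hid).
  by exists n, x; split=> //; apply: eval_const.
split=> -[y]; first by move=> [z /evalP ->]; exists y.
by move=> Hy; exists y, (pairn n x) => //; apply/evalP.
Qed.

Lemma computable_smn c : computable (fun n => encode (smn c n)).
Proof.
have Hk : computable (fun n => encode (const_code n)).
  (* If [z] encodes [c], then [5 + 4 * pairn 1 z] encodes [Comp Succ c]; the base 0 encodes
     [Zero]. *)
  have -> : (fun n => encode (const_code n)) =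
            (fun n => recn 0 (fun _ z => 5 + 4 * pairn 1 z) n).
    by apply/funext; elim=> [|n IH] //=; rewrite IH.
  by apply: (computable_rec (h := fun _ _ z => 5 + 4 * pairn 1 z)); computability.
by rewrite /smn /=; computability.
Qed.

(** For fixed [p], the axioms [<x, u>] such that some witness for [<p, x>] passes [b] and has query
    [u] form a c.e. set; [smn] computes an index of it from [p]. *)
Lemma enumerable_Gamma O (P : nat -> nat -> Prop) :
  enumerable O (fun z => P (fstn z) (sndn z)) ->
  exists2 f, computable f & forall p, Gamma (f p) O = P p.
Proof.
move=> [b [g [Hb Hg HP]]].
(* Here [z] is [<<p, <x, u>>, w>], and [arg z] is [<<p, x>, w>]. *)
pose arg z := pairn (pairn (fstn (fstn z)) (fstn (sndn (fstn z)))) (sndn z).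
have Harg : computable arg by rewrite /arg; computability.
have [|c Hc] := @ce_ex (fun z => b (arg z) && (g (arg z) == sndn (sndn (fstn z)))).
  by computability.
exists (fun p => encode (smn c p)); first exact: computable_smn.
move=> p; apply/seteqP; split=> x.
- move=> [u [Du]]; rewrite W_encode => /dom_smn; rewrite -Hc => -[w].
  rewrite /arg !pairnE => /andP[bw /eqP gw].
  have := (HP (pairn p x)).2; rewrite !pairnE; apply; exists w.
  by rewrite gw.
- move=> Px; have [|w [bw gw]] := (HP (pairn p x)).1; first by rewrite !pairnE.
  exists (g (pairn (pairn p x) w)); split=> //.
  rewrite W_encode; apply/dom_smn; rewrite -Hc; exists w.
  by rewrite /arg !pairnE bw eqxx.
Qed.

(** * Basic properties of enumeration reducibility *)

Lemma ce_W e : ce (W e).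
Proof.
by have : range W (W e) by [exists e]; rewrite range_W.
Qed.

Lemma le_e_enumerable O (X : set nat) : enumerable O X -> le_e X O.
Proof.
move=> HX; have [|f _ Hf] := @enumerable_Gamma O (fun _ x => X x).
  by apply: (enumerable_comp HX); computability.
by exists (W (f 0)); split; [exact: ce_W | exact: esym (Hf 0)].
Qed.

Lemma le_e_trans X Y O : le_e X Y -> le_e Y O -> le_e X O.
Proof.
move=> [G [[c ->]] ->] /enumerable_le_e HY; apply: le_e_enumerable.
apply: enumerable_ex; apply: enumerable_and.
  apply: enumerable_subset; computability.
  by apply: (enumerable_comp HY); computability.
by apply: enumerable_dom; computability.
Qed.

(** A bounded set is given by a finite list, obtained noneffectively by excluded middle, and
    membership in a fixed list is computable. *)
Lemma le_e_bounded (X : set nat) N O : (forall x, X x -> x < N) -> le_e X O.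
Proof.
move=> ltN; apply: le_e_enumerable.
apply: (@enumerable_iff _ (fun x => x \in [seq y <- iota 0 N | `[< X y >]])).
  move=> x; rewrite mem_filter mem_iota /= add0n; split; first by case/andP=> /asboolP.
  by move=> Xx; rewrite ltN // andbT; apply/asboolP.
by apply: enumerable_dec; computability.
Qed.

(** * The oracle [0'_e] *)

Lemma zero_jump_even k : zero_jump k.*2 <-> Kset set0 k.
Proof.
split=> [[[x Kx /double_inj<-] //|[x _] E]|Kk]; last by left; exists k.
by have := congr1 odd E; rewrite /= !odd_double.
Qed.

Lemma zero_jump_odd k : zero_jump k.*2.+1 <-> ~ Kset set0 k.
Proof.
split=> [[[x _] E|[x Kx [/double_inj<-]] //]|Kk]; last by right; exists k.
by have := congr1 odd E; rewrite /= !odd_double.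
Qed.

(** [2k] and [2k+1] answer opposite questions about [k], so exchanging them turns a negative oracle
    fact into a positive one. *)
Lemma zero_jump_flip x :
  ~ zero_jump x <-> zero_jump (if odd x then x.-1 else x.+1).
Proof.
rewrite -(odd_double_half x); case: (odd x) => /=; rewrite odd_double /=.
  by rewrite add1n zero_jump_odd zero_jump_even; split=> [/contrapT|Kx].
by rewrite add0n zero_jump_odd zero_jump_even.
Qed.

(** A failed inclusion has a positive certificate: an element of the finite set whose partner is in
    the oracle. Thus finite queries are decidable relative to [zero_jump]. *)
Lemma enumerable_not_query :
  enumerable zero_jump (fun u => ~ Dset u `<=` zero_jump).
Proof.
apply: (@enumerable_iff _ (fun u => exists x, bit u x /\
  zero_jump (if odd x then x.-1 else x.+1))).
  move=> u; split=> [[x [ux /zero_jump_flip Zx]] /(_ x ux) //|].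
  by move=> /existsNP[x /not_implyP[ux /zero_jump_flip Zx]]; exists x.
apply: enumerable_ex; apply: enumerable_and.
  by apply: enumerable_dec; computability.
apply: enumerable_oracle; apply: computable_if; computability.
by apply: computable_pred; computability.
Qed.

(* Halting of [c] on [x] is a single bit of the oracle: discarding the (empty)
   finite set, [x] is in [Gamma e' set0] for the index [e'] of [Comp c Fst]. *)
Lemma enumerable_W f g : computable f -> computable g ->
  enumerable zero_jump (fun x => W (f x) (g x)).
Proof.
(* As [Fst] has code 2, [5 + 4 * pairn (f x) 2] encodes [Comp c Fst] when [f x] encodes [c];
   doubling selects the left half of the join. *)
move=> Hf Hg; apply: (@enumerable_iff _ (fun x =>
  zero_jump (2 * pairn (5 + 4 * pairn (f x) 2) (g x)))); last first.
  by apply: enumerable_oracle; computability.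
move=> x; rewrite mul2n zero_jump_even; have [c <-] := encode_surj (f x).
rewrite -[5 + _]/(encode (Comp c Fst)) W_encode; split.
  move=> [_ [_ [/pairn_inj[<- <-]]]] [u [_]]; rewrite W_encode => -[y [z /= ->]].
  by rewrite -/(fstn _) pairnE; exists y.
move=> [y cy]; exists (encode (Comp c Fst)), (g x); split=> //.
exists 0; rewrite Dset0 W_encode; split=> //.
by exists y, (g x) => //=; rewrite -/(fstn _) pairnE.
Qed.

(** Both indices vary with [x], whereas [enumerable_dom] concerns a fixed program; [enumerable_W]
    supplies the uniformity. *)
Lemma enumerable_Gamma_Gamma a e f : computable a -> computable e -> computable f ->
  enumerable zero_jump (fun x => Gamma (e x) (Gamma (a x) zero_jump) (f x)).
Proof.
move=> Ha He Hf; apply: enumerable_ex; apply: enumerable_and.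
  apply: (@enumerable_subset _ (fun z => Gamma (a (fstn z)) zero_jump)); computability.
  apply: enumerable_ex; apply: enumerable_and.
    by apply: enumerable_query; computability.
  by apply: enumerable_W; computability.
by apply: enumerable_W; computability.
Qed.

(** * Approximation by agreeing stages *)

(** [S x w] says that [w] is a correct witness for [x]. This is a decidable test plus one finite
    query, and [enumerable_not_query] handles its negation. *)
Lemma enumerable_stages P : enumerable zero_jump P ->
  exists S : nat -> nat -> Prop,
  [/\ enumerable zero_jump (fun z => S (fstn z) (sndn z)),
      enumerable zero_jump (fun z => ~ S (fstn z) (sndn z)) &
      forall x, P x <-> exists w, S x w].
Proof.
move=> [b [g [Hb Hg HP]]].
exists (fun x w => b (pairn x w) /\ Dset (g (pairn x w)) `<=` zero_jump).
split=> //.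
  apply: enumerable_and; first by apply: enumerable_dec; computability.
  by apply: enumerable_query; computability.
apply: (@enumerable_iff _ (fun z => b z -> ~ Dset (g z) `<=` zero_jump)).
  by move=> z; rewrite pairnE; split=> [H [bz gz]|H bz gz]; apply: H.
apply: enumerable_imp => //.
by apply: (enumerable_comp enumerable_not_query).
Qed.

Lemma bounded_witnesses (P : nat -> Prop) (S : nat -> nat -> Prop) N :
  (forall x, P x -> exists w, S x w) ->
  exists t, forall x, x < N -> P x -> exists w, w < t /\ S x w.
Proof.
move=> PS; have /choice[h Hh] x : exists w, P x -> S x w.
  have [/PS[w Sw]|nPx] := pselect (P x); first by exists w.
  by exists 0 => /nPx.
exists (\max_(x < N) h x).+1 => x lt_x /Hh Sx; exists (h x); split=> //.
by rewrite ltnS; apply: (leq_bigmax (Ordinal lt_x)).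
Qed.

(* [Y p] collects the [x] that enter [X p] at some stage up to which the
   approximations to [X p] and [V p] agree on the initial segment [0, x]. *)
Lemma enumerable_equalizer (X V : nat -> nat -> Prop) :
  enumerable zero_jump (fun z => X (fstn z) (sndn z)) ->
  enumerable zero_jump (fun z => V (fstn z) (sndn z)) ->
  exists Y : nat -> set nat,
  [/\ enumerable zero_jump (fun z => Y (fstn z) (sndn z)),
      forall p, X p = V p -> Y p = X p &
      forall p, X p <> V p -> exists N, forall x, Y p x -> x < N].
Proof.
move=> /enumerable_stages[S [HS HnS XS]] /enumerable_stages[T [HT HnT VT]].
have {}XS p x : X p x <-> exists w, S (pairn p x) w by rewrite -XS !pairnE.
have {}VT p x : V p x <-> exists w, T (pairn p x) w by rewrite -VT !pairnE.
(* Agreement is spelled out as both in or both out, a positive combination of [S], [T] and their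
   enumerable negations. *)
pose agree p y t :=
  (exists w, w < t /\ S (pairn p y) w) /\ (exists w, w < t /\ T (pairn p y) w) \/
  (forall w, w < t -> ~ S (pairn p y) w) /\ (forall w, w < t -> ~ T (pairn p y) w).
(* The clause [x < t] keeps the contribution of early stages finite when the two sets differ. *)
exists (fun p => [set x | exists t, x < t /\
  ((exists w, w < t /\ S (pairn p x) w) /\ forall y, y < x.+1 -> agree p y t)]).
split.
- apply: enumerable_ex; apply: enumerable_and.
    by apply: enumerable_dec; computability.
  apply: enumerable_and.
    apply: enumerable_bex; computability.
    by apply: (enumerable_comp2 HS); computability.
  apply: enumerable_ball; computability.
  apply: enumerable_or; apply: enumerable_and.
  + apply: enumerable_bex; computability.
    by apply: (enumerable_comp2 HS); computability.
  + apply: enumerable_bex; computability.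
    by apply: (enumerable_comp2 HT); computability.
  + apply: enumerable_ball; computability.
    by apply: (enumerable_comp2 (P := fun q w => ~ S q w) HnS); computability.
  + apply: enumerable_ball; computability.
    by apply: (enumerable_comp2 (P := fun q w => ~ T q w) HnT); computability.
- move=> p XV; apply/seteqP; split=> x; first by
    move=> [t [_ [[w [_ Sw]] _]]]; apply/XS; exists w.
  move=> Xx.
  have [t Ht] := bounded_witnesses x.+1 (fun y => (XS p y).1).
  have [t' Ht'] := bounded_witnesses x.+1 (fun y => (VT p y).1).
  have weak (R : nat -> Prop) s s' : s <= s' ->
      (exists w, w < s /\ R w) -> exists w, w < s' /\ R w.
    by move=> le_s [w [lt_w Rw]]; exists w; split=> //; apply: leq_trans le_s.
  (* A stage beyond [x] by which both enumerations are complete on [0, x]. *)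
  exists (x.+1 + t + t'); split; first by lia.
  split=> [|y lt_y]; first by apply: weak (Ht x (ltnSn x) Xx); lia.
  have [Xy|nXy] := pselect (X p y); [left|right]; split.
  + by apply: weak (Ht y lt_y Xy); lia.
  + by rewrite XV in Xy; apply: weak (Ht' y lt_y Xy); lia.
  + by move=> w _ Sw; apply: nXy; apply/XS; exists w.
  + by move=> w _ Tw; apply: nXy; rewrite XV; apply/VT; exists w.
- move=> p XV.
  have [y nXV] : exists y, ~ (X p y <-> V p y).
    by apply/existsNP => H; apply: XV; apply/funext => y; apply/propext.
  (* At a stage past [w0] the point [y] has entered one of the sets; agreement there would put it in
     both. So any [x >= y] enters at a stage [t <= w0], and [x < t]. *)
  have [w0 Hw0] : exists w0, S (pairn p y) w0 \/ T (pairn p y) w0.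
    have [/XS[w Sw]|nX] := pselect (X p y); first by exists w; left.
    have [/VT[w Tw]|nV] := pselect (V p y); first by exists w; right.
    by case: nXV.
  exists (y + w0).+1 => x [t [lt_xt [_ Hag]]].
  have [lt_xy|le_yx] := ltnP x y; first by lia.
  suff : t <= w0 by lia.
  case: (Hag y le_yx) => [[[w [_ Sw]] [w' [_ Tw]]]|[nS nT]].
    by case: nXV; split=> _; [apply/VT; exists w'|apply/XS; exists w].
  rewrite leqNgt; apply/negP => lt_w0.
  by case: Hw0 => [/nS|/nT]; apply.
Qed.

(** * Construction of the Ahmad sequence *)

Lemma le_e_Gamma X O : le_e X O -> exists e, X = Gamma e O.
Proof.
move=> [G [ceG ->]]; have [e _ <-] : range W G by rewrite range_W.
by exists e.
Qed.

Lemma Gamma_le_e e O : le_e (Gamma e O) O.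
Proof. by exists (W e); split=> //; exact: ce_W. Qed.

Theorem theorem3p4 (n : nat) (hn : 0 < n)
    (A : set nat) (B : 'I_n -> set nat)
    (hA : Sigma02 A) (hB : forall i : 'I_n, Sigma02 (B i))
    (hAB : ahmad_pair A B) :
  exists f : nat -> nat, ahmad_sequence A f.
Proof.
have [nAB ltAB] := hAB.
have [a Ea] := le_e_Gamma hA.
have [b Eb] := choice (fun i => le_e_Gamma (hB i)).
pose bs := [seq b i | i <- enum 'I_n].
(* The parameter [p] is [<b i, <e, d>>]. The guard on [fstn p] makes both sets empty when the first
   component is not an index of some [B i]. *)
pose X p x := fstn p \in bs /\ Gamma (fstn (sndn p)) A x.
pose V p x := fstn p \in bs /\
  Gamma (sndn (sndn p)) (Gamma (fstn p) zero_jump) x.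
have HX : enumerable zero_jump (fun z => X (fstn z) (sndn z)).
  rewrite /X Ea; apply: enumerable_and; first by apply: enumerable_dec; computability.
  by apply: enumerable_Gamma_Gamma; computability.
have HV : enumerable zero_jump (fun z => V (fstn z) (sndn z)).
  apply: enumerable_and; first by apply: enumerable_dec; computability.
  by apply: enumerable_Gamma_Gamma; computability.
have [Y [HY YX Ybnd]] := enumerable_equalizer HX HV.
have [f Hf fY] := enumerable_Gamma HY.
have ltA Z i : le_e Z A -> le_e Z (B i) -> lt_e Z A.
  by move=> ZA ZB; split=> // AZ; apply: (nAB i); apply: le_e_trans ZB.
have XE p : fstn p \in bs -> X p = Gamma (fstn (sndn p)) A.
  by move=> Hp; apply/funext => x; apply/propext; split=> [[]|].
have VE p i : fstn p = b i -> V p = Gamma (sndn (sndn p)) (B i).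
  move=> Hp; apply/funext => x; apply/propext; rewrite /V Eb -Hp.
  by split=> [[]|] // HG; split=> //; rewrite Hp map_f ?mem_enum.
exists f; split=> //; apply/seteqP; split=> Z.
- move=> [p _ <-] /=; rewrite fY.
  have small N : (forall x, Y p x -> x < N) -> lt_e (Y p) A.
    (* A finite set lies below both [A] and [B 0], which exists since [0 < n]; hence it is strictly
       below [A]. *)
    by move=> H; apply: (ltA _ (Ordinal hn)); apply: le_e_bounded H.
  have [XV|/Ybnd[N]] := pselect (X p = V p); last exact: small.
  have [Hp|Hp] := boolP (fstn p \in bs); last first.
    by apply: (small 0) => x; rewrite YX // => -[]; rewrite (negbTE Hp).
  have /mapP[i _ Ei] := Hp.
  apply: (ltA _ i); rewrite YX //; first by rewrite XE //; exact: Gamma_le_e.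
  by rewrite XV (VE _ _ Ei); exact: Gamma_le_e.
- move=> ZA; have [i ZB] := ltAB Z ZA.
  have [e Ee] := le_e_Gamma ZA.1; have [d Ed] := le_e_Gamma ZB.
  (* With these indices both operators produce [Z], so the equalizer is [Z] itself. *)
  exists (pairn (b i) (pairn e d)) => //.
  have Ep : fstn (pairn (b i) (pairn e d)) = b i by rewrite pairnE.
  have Hp : fstn (pairn (b i) (pairn e d)) \in bs by rewrite Ep map_f ?mem_enum.
  rewrite fY YX ?XE ?(VE _ _ Ep) // !pairnE //.
  by rewrite -Ee.
Qed.
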